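(* Let $d\geq 2$, let $p\equiv 1\pmod d$ be a prime, and let $A\subset\mathbb{F}_p$. If $A\hat{+}A\subset S_d$, then $|A|\leq\sqrt{2(p-1)/d+1}+1$. If $A\hat{+}A\subset S_d\cup\{0\}$, then $|A|\leq\sqrt{2(p-1)/d+1}+2$.
   Context: $S_d=\{x^d: x\in\mathbb{F}_p^*\}$, the subgroup of $\mathbb{F}_p^*$ of order $\frac{p-1}{d}$. For $A\subset\mathbb{F}_p$, $A\hat{+}A=\{a+b: a,b\in A,\ a\neq b\}$. *)

(* Defs.v *)
From HB Require Import structures.
From mathcomp Require Import all_boot all_order all_algebra.

Set Implicit Arguments.
Unset Strict Implicit.
Unset Printing Implicit Defensive.

Import GRing.Theory.
Local Open Scope ring_scope.

Definition dpowers (p d : nat) : {set 'F_p} :=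
  [set x ^+ d | x : 'F_p & x != 0].

Definition restricted_sumset (p : nat) (A : {set 'F_p}) : {set 'F_p} :=
  [set a + b | a in A, b in A & a != b].

(* Main.v *)
Require Import Defs.
From HB Require Import structures.
From mathcomp Require Import all_boot all_order all_algebra.
From mathcomp Require Import finfield zify ring.

Set Implicit Arguments.
Unset Strict Implicit.
Unset Printing Implicit Defensive.

Import Order.TTheory GRing.Theory Num.Theory.
Local Open Scope ring_scope.

(**
  Stepanov's method.  Let q = (p - 1) / d, so that elements of S_d satisfy
  x^q = 1.  On M + m + 1 points a_i of A take the divided-difference weights
  c_i, which annihilate polynomials of degree < M + m and read off the
  coefficient of degree M + m, and put

    f = sum_i c_i (X + a_i)^(M + q) (a_i - X)^m - 1.

  The factor (a_i - X)^m makes the uncontrolled sums a_i + a_i harmless, and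
  every b in A is a root of f of multiplicity at least m, provided m <= M + 1
  (m <= M if sums may vanish).  The weights bring the degree of f down to at
  most q, and its coefficient of degree q is that of (X + 1)^(M + q) (1 - X)^m.
  If f is nonzero, then |A| m <= q.  That coefficient may vanish mod p, but no
  two consecutive coefficients do, so it is nonzero for M or for M + 1.  The
  bounds follow with M = m - 1, m = floor((|A| - 1) / 2) for sums in S_d, and
  with M = m, m = floor((|A| - 2) / 2) when 0 is allowed.
*)

(** * Weights, coefficients and multiplicities over a field *)

Section Polynomials.
Variable F : fieldType.
Implicit Types (a b : F) (s : seq F).

(** The weights form the last column of the inverse Vandermonde matrix, which exists because the
    points are distinct. *)
Lemma exists_moment_weights s : uniq s ->
  exists c : 'I_(size s) -> F, forall j, (j < size s)%N ->
    \sum_i c i * s`_i ^+ j = (j == (size s).-1)%:R.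
Proof.
move=> Us; set n := size s.
pose V := Vandermonde n (\row_(i < n) s`_i).
have uV : V \in unitmx.
  rewrite unitmxE det_Vandermonde unitfE.
  apply/prodf_neq0 => i _; apply/prodf_neq0 => j ltij.
  by rewrite !mxE subr_eq0 nth_uniq // gtn_eqF.
pose e : 'cV[F]_n := \col_i (val i == n.-1)%:R.
exists (fun i => (invmx V *m e) i 0) => j ltjn.
have := congr1 (fun M : 'cV_n => M (Ordinal ltjn) 0) (mulKVmx uV e).
rewrite !mxE /= => <-; apply: eq_bigr => i _.
by rewrite !mxE mulrC.
Qed.

(** [H] has coefficients in [{poly F}] so that the indeterminate ['X] can later count as a
    constant. *)
Lemma moment_weights_horner s (c : 'I_(size s) -> F) :
    (forall j, (j < size s)%N ->
      \sum_i c i * s`_i ^+ j = (j == (size s).-1)%:R) ->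
  forall H : {poly {poly F}}, (size H <= size s)%N -> (0 < size s)%N ->
    \sum_i (c i)%:P * H.[(s`_i)%:P] = H`_(size s).-1.
Proof.
move=> mc H szH s_gt0.
under eq_bigr => i _ do rewrite (horner_coef_wide _ szH) mulr_sumr.
rewrite exchange_big /=.
under eq_bigr => j _.
  under eq_bigr => i _ do rewrite mulrCA -polyC_exp -polyCM.
  rewrite -mulr_sumr -rmorph_sum /= mc //.
  over.
have lt_last : ((size s).-1 < size s)%N by rewrite prednK.
rewrite (bigD1 (Ordinal lt_last)) //= eqxx mulr1 big1 ?addr0 // => j.
by rewrite -val_eqE /= => /negPf ->; rewrite mulr0.
Qed.

(** The product is homogeneous of degree [N + m] in ['X] and [a] together. For [e > N + m] the
    truncated exponent is harmless, since both coefficients vanish. *)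
Lemma coef_XaddC_CsubX N m a e :
  (('X + a%:P) ^+ N * (a%:P - 'X) ^+ m)`_e =
  (('X + 1) ^+ N * (1 - 'X) ^+ m)`_e * a ^+ (N + m - e).
Proof.
have szX (x : F) i : (size (('X + x%:P) ^+ i) <= i.+1)%N.
  apply: leq_trans (size_poly_exp_leq _ _) _.
  by rewrite size_XaddC mul1n.
have szC (x : F) i : (size ((x%:P - 'X) ^+ i) <= i.+1)%N.
  apply: leq_trans (size_poly_exp_leq _ _) _.
  by rewrite -opprB size_polyN size_XsubC mul1n.
have top (x : F) i j k : (i + j < k)%N ->
    (('X + x%:P) ^+ i * (x%:P - 'X) ^+ j)`_k = 0.
  move=> ltk; apply: nth_default; apply: leq_trans (size_polyMleq _ _) _.
  by move: (szX x i) (szC x j); lia.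
rewrite -[1 in RHS]polyC1.
have [le_e|lt_e] := leqP e (N + m); last by rewrite !top // mul0r.
elim: N e le_e => [|N IHN] e.
  rewrite !expr0 !mul1r !add0n.
  elim: m e => [|m IHm] e.
    by rewrite leqn0 => /eqP->; rewrite !expr0 !mulr1.
  move=> le_em; rewrite !exprS !mulrBl !coefB !coefCM !coefXM mul1r.
  case: e le_em => [|e] le_em /=.
    by rewrite !subr0 IHm // subn0 subn0 exprS mulrCA.
  rewrite subSS [X in _ - X]IHm ?mulrBl; last by lia.
  congr (_ - _).
  have [le|lt] := leqP e.+1 m.
    by rewrite IHm // mulrCA -exprS subnSK.
  have := top a 0%N m e.+1 lt; have := top 1 0%N m e.+1 lt.
  by rewrite !expr0 !mul1r => -> ->; rewrite mulr0 mul0r.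
move=> le_em; rewrite !exprS -!mulrA !mulrDl !coefD !coefCM !coefXM mul1r.
case: e le_em => [|e] le_em /=.
  by rewrite !add0r IHN // !subn0 addSn exprS mulrCA.
rewrite addSn subSS IHN ?mulrDl; last by lia.
congr (_ + _).
have [le|lt] := leqP e.+1 (N + m).
  by rewrite IHN // mulrCA -exprS subnSK.
by rewrite !top // mulr0 mul0r.
Qed.

(* The recurrence is the differential equation
   (1 - X^2) Q' = (N (1 - X) - m (1 + X)) Q read off coefficientwise; two
   consecutive zeros would propagate up to the leading coefficient. *)
Lemma consecutive_coef_neq0 N m q :
    (forall k, (0 < k <= N + m)%N -> k%:R != 0 :> F) -> (q.+1 <= N + m)%N ->
  ((('X + 1) ^+ N * (1 - 'X) ^+ m : {poly F})`_q != 0) ||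
  ((('X + 1) ^+ N * (1 - 'X) ^+ m : {poly F})`_q.+1 != 0).
Proof.
move=> nz le_q; set Q : {poly F} := _ * _.
rewrite -negb_and; apply/negP => /andP[/eqP Qq /eqP Qq1].
have ode : Q^`() - 'X ^+ 2 * Q^`() =
    N%:R%:P * Q - N%:R%:P * ('X * Q) - m%:R%:P * Q - m%:R%:P * ('X * Q).
  (* Multiplying by [P] keeps the exponent [k], so no predecessor of [k] enters the equation. *)
  have dexp (P : {poly F}) k : P * (P ^+ k)^`() = k%:R%:P * P^`() * P ^+ k.
    rewrite polyC_natr deriv_exp -mulr_natl; case: k => [|k]; first by rewrite !mul0r mulr0.
    by rewrite mulrCA -!mulrA; congr (_ * _); rewrite mulrCA -exprS.
  have := dexp ('X + 1) N; have := dexp (1 - 'X) m.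
  rewrite /Q derivM !derivD derivN derivX (derivC 1).
  move: (('X + 1) ^+ N) (('X + 1) ^+ N)^`() ((1 - 'X) ^+ m)
    ((1 - 'X) ^+ m)^`() (N%:R%:P : {poly F}) (m%:R%:P : {poly F}).
  move=> U U' W W' n k EW EU.
  transitivity (((1 - 'X) * W) * (('X + 1) * U') +
    (('X + 1) * U) * ((1 - 'X) * W')); first by move: 'X => x; ring.
  by rewrite EW EU; move: 'X => x; ring.
have rec j : Q`_j.+2 *+ j.+2 =
    (N%:R - m%:R) * Q`_j.+1 + (j%:R - N%:R - m%:R) * Q`_j.
  have := congr1 (fun P : {poly F} => P`_j.+1) ode.
  have coefX (P : {poly F}) i : ('X * P)`_i.+1 = P`_i by rewrite coefXM.
  rewrite !coefB !coefCM expr2 -mulrA !coefX coef_deriv.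
  case: j => [|j]; first by rewrite coefXM subr0 => ->; ring.
  move/eqP; rewrite subr_eq coefX coef_deriv => /eqP->.
  by rewrite -[Q`_j.+1 *+ _]mulr_natl; ring.
have zero j : (q + j < N + m)%N -> Q`_(q + j) = 0 /\ Q`_(q + j).+1 = 0.
  elim: j => [|j IHj] ltj; first by rewrite addn0.
  have [|Q0 Q1] := IHj; first by lia.
  rewrite addnS; split=> //; apply/eqP.
  have := rec (q + j)%N; rewrite Q0 Q1 !mulr0 addr0 -mulr_natl => /eqP.
  by rewrite mulf_eq0 (negPf (nz _ _)) //; lia.
have [|_] := zero (N + m - q.+1)%N; first by lia.
have -> : (q + (N + m - q.+1)).+1 = (N + m)%N by lia.
have size_XD : size ('X + 1 : {poly F}) = 2 by rewrite -polyC1 size_XaddC.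
have size_XB : size (1 - 'X : {poly F}) = 2.
  by rewrite -opprB size_polyN -polyC1 size_XsubC.
have nzQ : Q != 0.
  by rewrite mulf_neq0 ?expf_neq0 // -size_poly_eq0 ?size_XD ?size_XB.
have szQ : size Q = (N + m).+1.
  rewrite size_mul ?expf_neq0 // -?size_poly_eq0 ?size_XD ?size_XB //.
  have szX (P : {poly F}) k : size P = 2 -> size (P ^+ k) = k.+1.
    move=> szP; have := size_exp P k; rewrite szP mul1n.
    have /prednK {2}<- : (0 < size (P ^+ k)%R)%N; last by move->.
    by rewrite size_poly_gt0 expf_neq0 // -size_poly_eq0 szP.
  by rewrite !szX // addSn addnS.
by move/eqP; apply/negP; rewrite -[(N + m)%N]/((N + m).+1.-1) -szQ
  -lead_coefE lead_coef_eq0.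
Qed.

(** Powers of distinct linear factors are coprime, so their product, of degree [size s * m], divides
    [f]. *)
Lemma size_roots_mult_leq s m (f : {poly F}) : uniq s -> f != 0 ->
    (forall b, b \in s -> ('X - b%:P) ^+ m %| f) ->
  (size s * m < size f)%N.
Proof.
move=> Us nzf dvf; pose P := \prod_(b <- s) ('X - b%:P) ^+ m.
have dP : P %| f.
  rewrite /P; elim: s Us dvf {P} => [|b s IHs] /= => [_ _|/andP[bs Us] dvf].
    by rewrite big_nil dvd1p.
  rewrite big_cons Gauss_dvdp; first apply/andP; first split.
  - by apply: dvf; rewrite inE eqxx.
  - by apply: IHs => // x xs; apply: dvf; rewrite inE xs orbT.
  rewrite big_seq; apply: (big_ind (fun g => coprimep _ g)).
  - exact: coprimep1.
  - by move=> g h cg ch; rewrite coprimepMr cg.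
  move=> x xs; apply: coprimep_expl; apply: coprimep_expr.
  rewrite coprimep_XsubC root_XsubC; by apply: contra bs => /eqP<-.
apply: leq_trans (dvdp_leq nzf dP).
have -> : P = (\prod_(b <- s) ('X - b%:P)) ^+ m by rewrite /P prodrXl.
have := size_exp (\prod_(b <- s) ('X - b%:P)) m.
rewrite size_prod_XsubC /= => <-.
rewrite prednK // size_poly_gt0 expf_neq0 //.
by rewrite -size_poly_eq0 size_prod_XsubC.
Qed.

(** * The auxiliary polynomial and the bound it yields *)

Definition stepanov_poly s (c : 'I_(size s) -> F) M m q : {poly F} :=
  \sum_i (c i)%:P * (('X + (s`_i)%:P) ^+ (M + q) * ((s`_i)%:P - 'X) ^+ m) - 1.

Section Stepanov.
Variables (s : seq F) (c : 'I_(size s) -> F) (M m q : nat).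
Hypotheses (size_s : size s = (M + m).+1) (m_gt0 : (0 < m)%N) (q_gt0 : (0 < q)%N).
Hypothesis moment_c : forall j, (j < size s)%N ->
  \sum_i c i * s`_i ^+ j = (j == (size s).-1)%:R.

(** Each term contributes a power of its point with exponent [M + q + m - e <= M + m], which the
    weights kill unless [e = q]. The final [- 1] only affects degree 0, below [q]. *)
Lemma coef_stepanov_poly e : (q <= e)%N ->
  (stepanov_poly c M m q)`_e =
  (('X + 1) ^+ (M + q) * (1 - 'X) ^+ m)`_e * (e == q)%:R.
Proof.
move=> le_qe; rewrite coefB coef1 (gtn_eqF (leq_trans q_gt0 le_qe)) subr0.
rewrite coef_sum.
under eq_bigr => i _ do rewrite coefCM coef_XaddC_CsubX mulrCA.
rewrite -mulr_sumr moment_c; last by rewrite size_s; lia.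
by congr (_ * _%:R); rewrite size_s; lia.
Qed.

Lemma size_stepanov_poly : (size (stepanov_poly c M m q) <= q.+1)%N.
Proof.
apply/leq_sizeP => e lt_qe.
by rewrite coef_stepanov_poly ?(ltnW lt_qe) // (gtn_eqF lt_qe) mulr0.
Qed.

(** As a polynomial in the point, each summand is monic of degree [M - k + m], and the weights
    return its coefficient of degree [M + m]. *)
Lemma moment_shifted b k : (k <= M)%N ->
  \sum_i (c i)%:P * ((s`_i + b)%:P ^+ (M - k) * ((s`_i)%:P - 'X) ^+ m) =
  (k == 0)%:R.
Proof.
move=> le_kM.
pose H : {poly {poly F}} :=
  ('X - (- b%:P)%:P) ^+ (M - k) * ('X - ('X : {poly F})%:P) ^+ m.
have monH : H \is monic by rewrite monicMl monic_exp ?monicXsubC.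
have szH : size H = (M - k + m).+1.
  rewrite /H size_Mmonic ?monic_exp ?monicXsubC //; last first.
    by rewrite monic_neq0 // monic_exp ?monicXsubC.
  by rewrite !size_exp_XsubC addSn addnS.
rewrite (eq_bigr (fun i => (c i)%:P * H.[(s`_i)%:P])); last first.
  by move=> i _; rewrite /H !hornerE opprK polyCD.
rewrite moment_weights_horner ?szH ?size_s //; last by lia.
case: k => [|k] in le_kM H monH szH *.
  by move: monH; rewrite monicE lead_coefE szH subn0 => /eqP.
by rewrite nth_default // szH; lia.
Qed.

(* Modulo ('X - b) ^+ m, Taylor expansion at b replaces the exponent M + q by
   exponents M - k, because (a + b) ^+ q = 1; the term a = b is killed by the
   factor (a - 'X) ^+ m, so nothing is required of b + b. *)
Lemma dvdp_stepanov_poly b : (m <= M.+1)%N ->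
    (forall a, a \in s -> a != b ->
      (a + b) ^+ q = 1 \/ a + b = 0 /\ (m <= M)%N) ->
  ('X - b%:P) ^+ m %| stepanov_poly c M m q.
Proof.
move=> le_mM sum_ab.
pose T a := \sum_(k < m) ('X - b%:P) ^+ k * (a + b)%:P ^+ (M - k)
              *+ 'C(M + q, k).
(* Only [k = 0] survives the weights, so the constant 1 is itself a weighted sum and can be
   subtracted term by term. *)
have sumT : \sum_i (c i)%:P * (T s`_i * ((s`_i)%:P - 'X) ^+ m) = 1.
  under eq_bigr => i _ do rewrite mulr_suml mulr_sumr.
  rewrite exchange_big /=.
  under eq_bigr => k _.
    under eq_bigr => i _.
      rewrite -mulrnAl -!mulrA mulrCA.
      over.
    rewrite -mulr_sumr moment_shifted; last by have := ltn_ord k; lia.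
    over.
  rewrite (bigD1 (Ordinal m_gt0)) //= big1 ?addr0.
    by rewrite bin0 expr0 mulr1.
  by move=> k; rewrite -val_eqE /= => /negPf->; rewrite mulr0.
rewrite /stepanov_poly -[X in _ %| _ - X]sumT -sumrB.
apply: (big_ind (fun g => _ %| g)) => [|g h|i _]; first exact: dvdp0.
  exact: dvdp_add.
rewrite -mulrBr -mulrBl; apply: dvdp_mull.
have [->|ne_ab] := eqVneq s`_i b.
  by apply: dvdp_mull; rewrite -[b%:P - 'X]opprB exprNn dvdp_mull.
apply: dvdp_mulr.
have -> : 'X + (s`_i)%:P = (s`_i + b)%:P + ('X - b%:P).
  by rewrite polyCD; ring.
(* Binomial terms with [k >= m] are divisible by [('X - b) ^+ m]; the others must match those of
   [T]. *)
rewrite [((s`_i + b)%:P + _) ^+ _]exprDn -(big_mkord xpredT (fun k => (s`_i + b)%:P ^+ (M + q - k) *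
  ('X - b%:P) ^+ k *+ 'C(M + q, k))) (@big_cat_nat _ _ _ m) //=; last by lia.
rewrite big_mkord addrAC /T -sumrB big1 ?add0r => [|k _].
  rewrite big_nat; apply: (big_ind (fun g => _ %| g)); first exact: dvdp0.
    by move=> g h; exact: dvdp_add.
  move=> k /andP[le_mk _]; rewrite -mulr_natl; apply: dvdp_mull.
  by apply: dvdp_mull; apply: dvdp_exp2l.
apply/eqP; rewrite subr_eq0; apply/eqP; rewrite mulrC; congr (_ * _ *+ _).
have lt_km := ltn_ord k.
rewrite -!polyC_exp; congr _%:P.
have [|sum1|[-> le_m]] := sum_ab s`_i _ ne_ab; first by rewrite mem_nth.
  by rewrite -addnBAC ?exprD ?sum1 ?mulr1 //; lia.
(* If [a + b = 0], both powers vanish because [k < m <= M] keeps [M - k] positive. *)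
by rewrite !expr0n; congr _%:R; lia.
Qed.
End Stepanov.

(** Only the first [M + m + 1] elements of [s] carry weights, but all of [s] consists of roots of
    multiplicity at least [m]. *)
Lemma size_mul_leq_of_coef_neq0 s M m q : uniq s -> (M + m < size s)%N ->
    (0 < m <= M.+1)%N -> (0 < q)%N ->
    {in s &, forall a b, a != b ->
      (a + b) ^+ q = 1 \/ a + b = 0 /\ (m <= M)%N} ->
    (('X + 1) ^+ (M + q) * (1 - 'X) ^+ m : {poly F})`_q != 0 ->
  (size s * m <= q)%N.
Proof.
move=> Us lt_s /andP[m_gt0 le_mM] q_gt0 sums nzK.
pose s' := take (M + m).+1 s.
have size_s' : size s' = (M + m).+1 by rewrite size_takel.
have [c moment_c] := exists_moment_weights (take_uniq (M + m).+1 Us).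
have fq := coef_stepanov_poly size_s' m_gt0 q_gt0 moment_c (leqnn q).
rewrite -ltnS.
apply: leq_trans (size_stepanov_poly size_s' m_gt0 q_gt0 moment_c).
apply: size_roots_mult_leq => // [|b bs].
  by apply: contraNneq nzK => f0; move: fq; rewrite f0 coef0 eqxx mulr1 => <-.
apply: dvdp_stepanov_poly => // a as' ne_ab.
by apply: sums => //; apply: mem_take as'.
Qed.

(** The size hypothesis leaves one spare point, so that [M.+1] is available when [M] fails. *)
Lemma restricted_sums_bound s M m q : uniq s -> (M + m + 1 < size s)%N ->
    (0 < m <= M.+1)%N -> (0 < q)%N ->
    (forall k, (0 < k <= M + q + m)%N -> k%:R != 0 :> F) ->
    {in s &, forall a b, a != b ->
      (a + b) ^+ q = 1 \/ a + b = 0 /\ (m <= M)%N} ->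
  (size s * m <= q)%N.
Proof.
move=> Us lt_s m_bounds q_gt0 nz sums.
have [K0|] := eqVneq ((('X + 1) ^+ (M + q) * (1 - 'X) ^+ m : {poly F})`_q) 0;
  last by apply: size_mul_leq_of_coef_neq0 => //; lia.
apply: (@size_mul_leq_of_coef_neq0 _ M.+1) => //; try by lia.
  move=> a b sa sb /(sums a b sa sb)[|[ab0 le_mM]]; first by left.
  by right; split=> //; lia.
(* The extra factor ['X + 1] adds the coefficient of degree [q - 1] to the one of degree [q], which
   is 0 here. *)
have := @consecutive_coef_neq0 (M + q) m q.-1 nz.
rewrite prednK // K0 eqxx orbF addSn exprS -mulrA mulrDl coefD mul1r K0 addr0.
rewrite coefXM gtn_eqF //; apply; lia.
Qed.

End Polynomials.

(** * Application to the prime field *)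

Section PrimeField.
Variables (p d : nat).
Hypotheses (d_ge2 : (2 <= d)%N) (p_pr : prime p) (p_mod_d : p = 1 %[mod d]).
Let q := (p.-1 %/ d)%N.

Lemma order_mulE : (q * d = p.-1)%N.
Proof.
apply: divnK; rewrite -subn1 -eqn_mod_dvd ?prime_gt0 //.
exact/eqP.
Qed.

Lemma dpowers_expr x : x \in dpowers p d -> x ^+ q = 1.
Proof.
case/imsetP=> y; rewrite inE => nz_y ->; rewrite -exprM mulnC order_mulE.
apply: (mulfI nz_y); rewrite mulr1 -exprS prednK ?prime_gt0 //.
by have := expf_card y; rewrite card_Fp.
Qed.

Lemma natr_Fp_neq0 k : (0 < k < p)%N -> k%:R != 0 :> 'F_p.
Proof.
by case/andP=> k0 kp; rewrite -(dvdn_pcharf (pchar_Fp p_pr)) gtnNdvd.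
Qed.

(** For a fixed [b] in [A], the sums [b + a] with [a != b] are distinct roots of [P]. This crude
    bound on [#|A|] serves to check [M + q + m < p]. *)
Lemma card_le_size_restricted (A : {set 'F_p}) (P : {poly 'F_p}) : P != 0 ->
    {in A &, forall a b, a != b -> root P (a + b)} ->
  (#|A| <= size P)%N.
Proof.
move=> nzP rootP.
have [->|[b bA]] := set_0Vmem A; first by rewrite cards0.
rewrite (cardsD1 b) bA add1n cardE.
rewrite -(size_map (+%R b)); apply: max_poly_roots => //.
  apply/allP => _ /mapP[a + ->]; rewrite mem_enum !inE => /andP[ne_ab aA].
  by rewrite addrC; apply: rootP.
by rewrite map_inj_uniq ?enum_uniq //; apply: addrI.
Qed.

Lemma mem_restricted_sumset (A : {set 'F_p}) (a b : 'F_p) :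
  a \in A -> b \in A -> a != b -> a + b \in restricted_sumset A.
Proof.
by move=> aA bA ne; apply/imset2P; apply: (Imset2spec aA _ erefl); rewrite inE bA.
Qed.

Lemma order_gt0 : (0 < q)%N.
Proof. by have := order_mulE; have := prime_gt1 p_pr; case: q; lia. Qed.

Lemma double_order_lt : (2 * q < p)%N.
Proof. by have := order_mulE; have := prime_gt1 p_pr; nia. Qed.

Lemma restricted_sums_card (A : {set 'F_p}) M m : (M + m + 1 < #|A|)%N ->
    (0 < m <= M.+1)%N -> (M + q + m < p)%N ->
    {in A &, forall a b, a != b ->
      (a + b) ^+ q = 1 \/ a + b = 0 /\ (m <= M)%N} ->
  (#|A| * m <= q)%N.
Proof.
rewrite cardE => lt_A m_bounds lt_p sums.
apply: (restricted_sums_bound (enum_uniq _) lt_A m_bounds order_gt0) => [k k_bounds|].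
  by apply: natr_Fp_neq0; lia.
by move=> a b; rewrite !mem_enum; apply: sums.
Qed.

Lemma card_sums_dpowers (A : {set 'F_p}) :
    restricted_sumset A \subset dpowers p d ->
  (#|A| * #|A|.-2 <= 2 * q)%N.
Proof.
move/subsetP=> sub.
have sums : {in A &, forall a b, a != b -> (a + b) ^+ q = 1}.
  by move=> a b aA bA ne; apply/dpowers_expr/sub/mem_restricted_sumset.
have q0 := order_gt0; have q2 := double_order_lt.
have szX : size ('X^q - 1 : {poly 'F_p}) = q.+1 by rewrite size_XnsubC.
have leA : (#|A| <= q.+1)%N.
  rewrite -szX; apply: card_le_size_restricted => [|a b aA bA ne].
    by rewrite -size_poly_eq0 szX.
  by rewrite rootE !hornerE sums // subrr.
have [le2|gt2] := leqP #|A| 2; first by case: #|A| le2 => [|[|[]]].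
have [m mA] : exists m, (m.*2.+1 <= #|A| <= m.*2.+2)%N.
  by exists (#|A|.-1)./2; have := odd_double_half #|A|.-1; lia.
have : (#|A| * m <= q)%N; last by nia.
(* Here [M + m = 2m - 1 <= #|A| - 2 < q], so [M + q + m < 2q < p]. *)
apply: (@restricted_sums_card A m.-1); try by lia.
by move=> a b aA bA ne; left; apply: sums.
Qed.

Lemma card_sums_dpowers0 (A : {set 'F_p}) :
    restricted_sumset A \subset dpowers p d :|: [set 0] ->
  (#|A|.-1 * #|A|.-1.-2 <= 2 * q)%N.
Proof.
move/subsetP=> sub.
have sums : {in A &, forall a b, a != b -> (a + b) ^+ q = 1 \/ a + b = 0}.
  move=> a b aA bA ne.
  by have := sub _ (mem_restricted_sumset aA bA ne); rewrite !inE => /orP[/dpowers_expr|/eqP];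
    [left|right].
have q0 := order_gt0; have q2 := double_order_lt.
have szX : size ('X * ('X^q - 1) : {poly 'F_p}) = q.+2.
  have szX1 : size ('X^q - 1 : {poly 'F_p}) = q.+1 by rewrite size_XnsubC.
  by rewrite size_mul ?size_polyX ?szX1 ?polyX_eq0 // -size_poly_eq0 szX1.
have leA : (#|A| <= q.+2)%N.
  rewrite -szX; apply: card_le_size_restricted => [|a b aA bA ne].
    by rewrite -size_poly_eq0 szX.
  rewrite rootE !hornerE.
  by case: (sums a b aA bA ne) => ->; rewrite ?subrr ?mulr0 ?mul0r.
have [le3|gt3] := leqP #|A| 3; first by case: #|A| le3 => [|[|[|[]]]].
have [m mA] : exists m, (m.*2.+2 <= #|A| <= m.*2.+3)%N.
  by exists (#|A|.-2)./2; have := odd_double_half #|A|.-2; lia.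
have : (#|A| * m <= q)%N; last by nia.
(* Now [M + m = 2m <= #|A| - 2 <= q], so [M + q + m <= 2q < p]. *)
apply: (@restricted_sums_card A m); try by lia.
by move=> a b aA bA /(sums a b aA bA)[]; [left|right].
Qed.

(** Both bounds come from here with [n + k = #|A|]: [k = 0] for sums in [S_d], [k = 1] when 0 is
    allowed. *)
Lemma natr_le_sqrt_add (R : rcfType) n k : (n.-1 ^ 2 <= 2 * q + 1)%N ->
  (n + k)%:R <= Num.sqrt (2 * (p%:R - 1) / d%:R + 1) + k.+1%:R :> R.
Proof.
move=> le_n.
have -> : 2 * (p%:R - 1) / d%:R + 1 = (2 * q + 1)%:R :> R.
  have -> : p%:R - 1 = q%:R * d%:R :> R.
    by rewrite -natrM order_mulE -[p in LHS]prednK ?prime_gt0 // -natr1 addrK.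
  have nz_d : d%:R != 0 :> R by rewrite pnatr_eq0; lia.
  by rewrite mulrA mulfK // natrD natrM.
have le1 : (n + k <= n.-1 + k.+1)%N by lia.
apply: le_trans (_ : (n.-1 + k.+1)%:R <= _); first by rewrite ler_nat.
rewrite natrD lerD2r -[n.-1%:R]ger0_norm ?ler0n // -sqrtr_sqr.
by rewrite ler_wsqrtr // -natrX ler_nat.
Qed.

End PrimeField.

Theorem theorem1p6 (R : rcfType) (d p : nat) (hd : (2 <= d)%N)
    (hp : prime p) (hpd : p = 1 %[mod d]) (A : {set 'F_p}) :
  (restricted_sumset A \subset dpowers p d ->
     #|A|%:R <= Num.sqrt (2 * (p%:R - 1) / d%:R + 1) + 1 :> R) /\
  (restricted_sumset A \subset dpowers p d :|: [set 0] ->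
     #|A|%:R <= Num.sqrt (2 * (p%:R - 1) / d%:R + 1) + 2 :> R).
Proof.
split=> sub.
  have le_A := card_sums_dpowers hd hp hpd sub.
  rewrite -[#|A|]addn0; apply: natr_le_sqrt_add => //.
  (* Completing the square: [n (n - 2) + 1 = (n - 1)^2]. *)
  by case: #|A| le_A => [|[|n]] /=; nia.
have le_A := card_sums_dpowers0 hd hp hpd sub.
case: #|A| le_A => [|n] le_A; first by rewrite addr_ge0 ?sqrtr_ge0 ?ler0n.
rewrite -addn1; apply: natr_le_sqrt_add => //.
by case: n le_A => [|[|n]] /=; nia.
Qed.
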